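(* Let $\mathbb{K}$ be a field and $R=\mathbb{K}[x_1,\dots,x_n]$. If $I\subset R$ is an unmixed ass-decomposable monomial ideal, then $$\mathrm{sdepth}(R/I)\geq\mathrm{depth}(R/I).$$
   Context: Depth is taken with respect to the graded maximal ideal $\mathfrak{m}=(x_1,\dots,x_n)$. For an ideal $I\subseteq R$, $\mathrm{ass}(I)$ is the set of associated primes of $R/I$. An ideal $I$ is unmixed if $\dim R/I=\dim R/\mathfrak{p}$ for all $\mathfrak{p}\in\mathrm{ass}(I)$. Recursively, a (proper) monomial ideal $I\subset R$ is called ass-decomposable if either it is a primary ideal, or else there exist a variable $x_i\notin\sqrt{I}$ and a positive integer $k$ such that (i) $\mathrm{ass}(I+(x_i^k))=\{\mathfrak{p}\in\mathrm{ass}(I) : x_i\in\mathfrak{p}\}$, and (ii) both $I+(x_i^k)$ and $I:x_i^k$ are ass-decomposable. Stanley depth: for a finitely generated $\mathbb{Z}^n$-graded $R$-module $M\neq 0$, a Stanley decomposition of $M$ is a finite direct sum decomposition $M=\bigoplus_{j=1}^{m}u_j\mathbb{K}[Z_j]$ as a $\mathbb{Z}^n$-graded $\mathbb{K}$-vector space, where each $u_j\in M$ is homogeneous, $Z_j\subseteq\{x_1,\dots,x_n\}$, and $u_j\mathbb{K}[Z_j]$ is a free $\mathbb{K}[Z_j]$-module. Its Stanley depth is $\min_j|Z_j|$, and $\mathrm{sdepth}(M)$ is the maximum of the Stanley depths of all Stanley decompositions of $M$. *)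

(* Defs.v *)
From HB Require Import structures.
From mathcomp Require Import all_boot all_order all_algebra.
From mathcomp Require Import generic_quotient ring_quotient.
From mathcomp Require Import mpoly.
From mathcomp Require boolp.

Set Implicit Arguments.
Unset Strict Implicit.
Unset Printing Implicit Defensive.

Import GRing.Theory.

Local Open Scope ring_scope.
Local Open Scope quotient_scope.

Definition is_max (P : nat -> Prop) (d : nat) : Prop :=
  P d /\ forall e, P e -> (e <= d)%N.

(* {ideal_quot I} as an R-module, by restriction of scalars along R -> R/I *)
Section QuotientModule.
Variables (R : comNzRingType) (I : idealr R).

Definition quot_scale (a : R) (v : {ideal_quot I}) : {ideal_quot I} :=
  \pi_{ideal_quot I} a * v.

Fact quot_scaleA a b v : quot_scale a (quot_scale b v) = quot_scale (a * b) v.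
Proof. by rewrite /quot_scale rmorphM mulrA. Qed.

Fact quot_scale1 : left_id 1 quot_scale.
Proof. by move=> v; rewrite /quot_scale rmorph1 mul1r. Qed.

Fact quot_scaleDr : right_distributive quot_scale +%R.
Proof. by move=> a v w; rewrite /quot_scale mulrDr. Qed.

Fact quot_scaleDl v : {morph quot_scale^~ v : a b / a + b}.
Proof. by move=> a b; rewrite /quot_scale rmorphD mulrDl. Qed.

HB.instance Definition _ := GRing.Zmodule_isLmodule.Build R (Quotient.quot I)
  quot_scaleA quot_scale1 quot_scaleDr quot_scaleDl.

End QuotientModule.

Section Ideals.
Variable R : comNzRingType.
Implicit Types (I J : {pred R}) (p : prime_idealr R).

Definition ideal_gen (S : R -> Prop) (f : R) : Prop :=
  exists k (c g : 'I_k -> R), (forall j, S (g j)) /\ f = \sum_j c j * g j.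

Definition principal (a : R) : {pred R} :=
  [pred f | boolp.asbool (exists b, f = b * a)].

Definition ideal_add I J : {pred R} :=
  [pred f | boolp.asbool (exists g h, [/\ g \in I, h \in J & f = g + h])].

Definition colon I (a : R) : {pred R} := [pred f | f * a \in I].

Definition in_radical I (f : R) : Prop := exists k, f ^+ k \in I.

Definition primary_ideal I : Prop :=
  idealr_closed I /\
  forall f g, f * g \in I -> f \in I \/ in_radical I g.

(* p is in ass(I): the annihilator of the class of f in R/I is I : f *)
Definition associated_prime I p : Prop := exists f, p =i colon I f.

(* Krull dimension: d is the largest length of a chain of prime ideals
   c_0 < c_1 < ... < c_d *)
Definition is_krull_dim (d : nat) : Prop :=
  is_max (fun e => exists c : 'I_e.+1 -> prime_idealr R,
    forall i j : 'I_e.+1, (i < j)%N ->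
      {subset c i <= c j} /\ ~ {subset c j <= c i}) d.

End Ideals.

Definition unmixed (R : comNzRingType) (I : idealr R) : Prop :=
  forall p : prime_idealr R, associated_prime I p ->
  forall d, is_krull_dim {ideal_quot I} d <-> is_krull_dim {ideal_quot p} d.

Section Depth.
Variables (R : comNzRingType) (M : lmodType R).

(* v lies in (f_0, ..., f_(i-1)) M *)
Definition in_prefix_span r (f : 'I_r -> R) (i : nat) (v : M) : Prop :=
  exists w : 'I_r -> M, v = \sum_(j < r | (j < i)%N) f j *: w j.

Definition regular_sequence r (f : 'I_r -> R) : Prop :=
  (forall (i : 'I_r) (v : M),
     in_prefix_span f i (f i *: v) -> in_prefix_span f i v)
  /\ exists v : M, ~ in_prefix_span f r v.

Definition is_depth (J : R -> Prop) (d : nat) : Prop :=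
  is_max (fun r => exists f : 'I_r -> R,
    (forall i, J (f i)) /\ regular_sequence f) d.

End Depth.

Section Polynomials.
Variables (K : fieldType) (n : nat).
Local Notation R := {mpoly K[n]}.

Definition irrelevant_ideal : R -> Prop :=
  ideal_gen (fun g => exists i : 'I_n, g = 'X_i).

Definition monomial_ideal (I : {pred R}) : Prop :=
  exists S : 'X_{1..n} -> Prop, forall f, f \in I <->
    ideal_gen (fun g => exists2 m, S m & g = 'X_[m]) f.

Inductive ass_decomposable (I : {pred R}) : Prop :=
| AssDecPrimary of monomial_ideal I & primary_ideal I
| AssDecSplit (i : 'I_n) (k : nat) of
    idealr_closed I & monomial_ideal I &
    ~ in_radical I 'X_i & (0 < k)%N &
    (forall p : prime_idealr R,
       associated_prime (ideal_add I (principal ('X_i ^+ k))) p <->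
       associated_prime I p /\ 'X_i \in p) &
    ass_decomposable (ideal_add I (principal ('X_i ^+ k))) &
    ass_decomposable (colon I ('X_i ^+ k)).

(* The subring K[Z] of R, for a set Z of (indices of) variables *)
Definition subpoly (Z : {set 'I_n}) : {pred R} :=
  [pred f | all (fun m : 'X_{1..n} => [forall i, (m i != 0%N) ==> (i \in Z)])
                (msupp f)].

Section StanleyDepth.
(* M is Z^n-graded: piece a is the homogeneous component of multidegree a *)
Variables (M : lmodType R) (piece : 'rV[int]_n -> M -> Prop).

Definition in_stanley_space (u : M) (Z : {set 'I_n}) (v : M) : Prop :=
  exists2 f, f \in subpoly Z & v = f *: u.

(* As the u j are homogeneous, the subspaces u j * K[Z j] are automatically
   graded, so a direct sum of vector spaces is one of graded vector spaces. *)
Definition stanley_decomposition m (u : 'I_m -> M) (Z : 'I_m -> {set 'I_n}) :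
    Prop :=
  [/\ forall j, exists a, piece a (u j),
      forall j f, f \in subpoly (Z j) -> f *: u j = 0 -> f = 0 &
      forall v, exists! w : {ffun 'I_m -> M},
        (forall j, in_stanley_space (u j) (Z j) (w j)) /\ v = \sum_j w j].

(* For M != 0 a decomposition has at least one summand, and #|Z j| <= n, so
   that the default value n of the iterated minimum plays no role. *)
Definition is_sdepth (d : nat) : Prop :=
  is_max (fun e => exists m (u : 'I_m -> M) (Z : 'I_m -> {set 'I_n}),
    stanley_decomposition u Z /\ e = \big[minn/n]_(j < m) #|Z j|) d.

End StanleyDepth.

(* The Z^n-grading on R/I induced by the one on R, where 'X_[m] has
   multidegree m; components outside N^n are 0. *)
Definition quot_piece (I : idealr R) (a : 'rV[int]_n) (v : {ideal_quot I}) :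
    Prop :=
  exists2 f : R, v = \pi_{ideal_quot I} f &
    forall m, m \in msupp f -> forall i, a 0 i = (m i)%:Z.

End Polynomials.

Arguments is_krull_dim : clear implicits.
Arguments is_depth {R} M J d.
Arguments irrelevant_ideal : clear implicits.

(* Main.v *)
Require Import Defs.
From HB Require Import structures.
From mathcomp Require Import all_boot all_order all_algebra.
From mathcomp Require Import generic_quotient ring_quotient.
From mathcomp Require Import mpoly.
From mathcomp Require Import ring.
From mathcomp Require boolp.

(** Every associated prime [p] of [R/I] is generated by variables; let [Z] be
    the set of the other ones, so that [R/p = K[Z]].  The theorem follows from
    two facts:
    - [R/I] has a Stanley decomposition in which the variable set of each
      summand contains the set [Z] of some associated prime [p]
      ([ass_decomposable_partition], [partition_stanley]);
    - [depth (R/I) <= #|Z|] for each associated prime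
      ([regular_sequence_bound]).

    For the first fact, as [I] is monomial, it is enough to partition the set of
    monomials outside [I] into pieces [a + N^Z].  If [I] is primary, with the
    variables of its radical indexed by [A], the other variables are regular
    modulo [I]; the pieces are [a + N^(~: A)], where [a] runs over the finitely
    many monomials outside [I] in the variables in [A].  Otherwise, the exact
    sequence [0 -> R/(I : x^k) -> R/I -> R/(I + (x^k)) -> 0] glues partitions
    for the outer terms; the primes associated with [I : x^k] are associated
    with [I], and so are those associated with [I + (x^k)] by the definition of
    ass-decomposability.

    For the second fact, let [f_1, .., f_r] be a regular sequence on [R/I] in
    the maximal ideal, and choose [v] outside [I] with [p v] contained in [I].
    The powers [f_i^N] again form a regular sequence ([regular_seq_expr]), and
    [v] is not in [I + (f_1^N, .., f_r^N)] for large [N], because the terms of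
    low degree of the elements of this ideal are in [I]
    ([notin_foldl_high]).  Hence the power products of the [f_i^N], multiplied
    by [v], are linearly independent modulo [I] ([power_prod_free]), so that
    these power products are linearly independent in [R/p = K[Z]].  Among them,
    [d^r] have exponents below [d], and hence degree at most linear in [d],
    while the space of polynomials in [K[Z]] of degree at most [e] has dimension
    at most [(e + 1)^#|Z|].  Letting [d] grow gives [r <= #|Z|]
    ([free_mod_vars_bound], [expn_growth]). *)
Set Implicit Arguments.
Unset Strict Implicit.
Unset Printing Implicit Defensive.

Import GRing.Theory.

Local Open Scope ring_scope.
Local Open Scope quotient_scope.

(** * Regular sequences modulo an ideal *)

Section RegularModIdeal.
Variable R : comNzRingType.
Implicit Types (P Q : {pred R}) (f g v : R) (s : seq R).

(** Unlike [idealr_closed], this allows the unit ideal: enlarging an ideal by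
    elements of a regular sequence may make it improper. *)
Definition ideal_pred Q : Prop :=
  0 \in Q /\ forall a, {in Q &, forall u v, a * u + v \in Q}.

Definition add_elt Q f : {pred R} := ideal_add Q (principal f).

Definition regular_mod Q f : Prop := forall v, f * v \in Q -> v \in Q.

(** A weakly regular sequence on [R/Q].  All modules that occur are cyclic,
    so it is enough to let the ideal vary. *)
Fixpoint regular_seq Q s : Prop :=
  if s is f :: s'
  then regular_mod Q f /\ regular_seq (add_elt Q f) s' else True.

Lemma idealr_pred Q : idealr_closed Q -> ideal_pred Q.
Proof. by case=> Q0 _ QD; split. Qed.

Lemma ideal_predD Q u v : ideal_pred Q -> u \in Q -> v \in Q -> u + v \in Q.
Proof. by case=> _ QD Qu Qv; rewrite -[u]mul1r QD. Qed.

Lemma ideal_predM Q a u : ideal_pred Q -> u \in Q -> a * u \in Q.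
Proof. by case=> Q0 QD Qu; rewrite -[_ * _]addr0 QD. Qed.

Lemma ideal_predB Q u v : ideal_pred Q -> u \in Q -> v \in Q -> u - v \in Q.
Proof.
by move=> Qi Qu Qv; rewrite ideal_predD // -mulN1r ideal_predM.
Qed.

Lemma ideal_pred_sum Q (T : Type) (r : seq T) (p : pred T) (F : T -> R) :
  ideal_pred Q -> (forall i, p i -> F i \in Q) -> \sum_(i <- r | p i) F i \in Q.
Proof.
move=> Qi QF; elim/big_ind: _ => //; first by case: Qi.
by move=> u v; apply: ideal_predD.
Qed.

Lemma add_eltP Q f g :
  reflect (exists a b, a \in Q /\ g = a + b * f) (g \in add_elt Q f).
Proof.
apply: (iffP (boolp.asboolP _)) => [[a [_ [Qa /boolp.asboolP[b ->] ->]]]|].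
  by exists a, b.
case=> a [b [Qa ->]]; exists a, (b * f); split=> //.
by apply/boolp.asboolP; exists b.
Qed.

Lemma sub_add_elt Q f g : g \in Q -> g \in add_elt Q f.
Proof. by move=> Qg; apply/add_eltP; exists g, 0; rewrite mul0r addr0. Qed.

Lemma add_elt_ideal Q f : ideal_pred Q -> ideal_pred (add_elt Q f).
Proof.
move=> Qi; split; first by apply: sub_add_elt; case: Qi.
move=> a _ _ /add_eltP[u1 [b1 [Q1 ->]]] /add_eltP[u2 [b2 [Q2 ->]]].
apply/add_eltP; exists (a * u1 + u2), (a * b1 + b2).
by split; [case: Qi => _; apply | ring].
Qed.

Lemma eq_add_elt P Q f : P =i Q -> add_elt P f =i add_elt Q f.
Proof.
by move=> PQ g; apply/add_eltP/add_eltP => -[a [b [Qa ->]]]; exists a, b;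
  rewrite ?PQ // -?PQ.
Qed.

Lemma add_eltC Q f g : add_elt (add_elt Q f) g =i add_elt (add_elt Q g) f.
Proof.
suffices sub u v h :
    h \in add_elt (add_elt Q u) v -> h \in add_elt (add_elt Q v) u.
  by move=> h; apply/idP/idP; apply: sub.
case/add_eltP=> _ [b [/add_eltP[a [c [Qa ->]]] ->]]; rewrite addrAC.
apply/add_eltP; exists (a + b * v), c; split=> //.
by apply/add_eltP; exists a, b.
Qed.

Lemma eq_regular_seq P Q s : P =i Q -> regular_seq P s -> regular_seq Q s.
Proof.
elim: s P Q => //= f s IHs P Q PQ [regf regs]; split.
  by move=> v; rewrite -!PQ; apply: regf.
by apply: IHs regs; apply: eq_add_elt.
Qed.

(** The exact sequence [0 -> R/(P : f) -> R/P -> R/(P + f) -> 0]: a sequence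
    that is regular on both outer terms is regular on the middle one.  The
    first element [g] of the sequence is regular on the right-hand term, so
    [(P + g) : f = (P : f) + g], i.e. the sequence stays exact modulo [g], and
    one can go on with the remaining elements. *)
Lemma regular_seq_extension P f s :
  ideal_pred P -> regular_seq (colon P f) s -> regular_seq (add_elt P f) s ->
  regular_seq P s.
Proof.
elim: s P => //= g s IHs P Pi [regCg regCs] [regDg regDs]; split.
  move=> v Pgv.
  have /add_eltP[a [w [Pa def_v]]] := regDg v (sub_add_elt f Pgv).
  suffices: w \in colon P f.
    by rewrite inE => Pwf; rewrite def_v ideal_predD.
  apply: regCg; rewrite inE -mulrA.
  have -> : g * (w * f) = g * v - g * a by rewrite def_v; ring.
  by apply: ideal_predB => //; apply: ideal_predM.
apply: IHs; first exact: add_elt_ideal.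
  apply: eq_regular_seq regCs => w; rewrite [RHS]inE; apply/add_eltP/add_eltP.
    case=> a [b [Pa ->]]; exists (a * f), (b * f); split=> //; ring.
  case=> a [u [Pa def_wf]].
  have /add_eltP[b [c [Pb def_u]]] : u \in add_elt P f.
    apply: regDg; apply/add_eltP; exists (- a), w.
    split; last by rewrite def_wf; ring.
    by rewrite -mulN1r ideal_predM.
  exists (w - c * g), c; split; last by ring.
  rewrite inE mulrBl def_wf def_u.
  have -> : a + (b + c * f) * g - c * g * f = g * b + a by ring.
  by case: Pi => _; apply.
by apply: eq_regular_seq regDs; apply: add_eltC.
Qed.

Lemma regular_seq_expr_head Q f s a :
  ideal_pred Q -> regular_seq Q (f :: s) -> regular_seq Q (f ^+ a.+1 :: s).
Proof.
move=> Qi [regf regs]; elim: a => [|a [regfa regsa]]; first by rewrite expr1.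
split.
  by move=> v; rewrite exprS -mulrA => /regf /regfa.
(* R/(Q + f^(a+2)) is an extension of R/(Q + f) by a copy of R/(Q + f^(a+1)) *)
apply: (@regular_seq_extension _ f); first exact: add_elt_ideal.
  apply: eq_regular_seq regsa => w; rewrite [RHS]inE; apply/add_eltP/add_eltP.
    case=> u [b [Qu ->]]; exists (f * u), b; rewrite ideal_predM //; split=> //.
    by rewrite [in RHS]exprS; ring.
  case=> u [b [Qu def_wf]]; exists (w - b * f ^+ a.+1), b; split; last by ring.
  apply: regf; suffices -> : f * (w - b * f ^+ a.+1) = u by [].
  rewrite mulrBr [f * w]mulrC def_wf [in LHS]exprS; ring.
apply: eq_regular_seq regs => w; apply/add_eltP/add_eltP => [[u [b [Qu ->]]]|].
  by exists u, b; rewrite sub_add_elt.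
case=> _ [b [/add_eltP[u [c [Qu ->]]] ->]].
by exists u, (c * f ^+ a.+1 + b); split=> //; rewrite [in LHS]exprS; ring.
Qed.

Lemma regular_seq_expr Q s a :
  ideal_pred Q -> regular_seq Q s -> regular_seq Q [seq f ^+ a.+1 | f <- s].
Proof.
elim: s Q => //= f s IHs Q Qi /(regular_seq_expr_head a Qi)[regf regs].
by split=> //; apply: IHs regs; apply: add_elt_ideal.
Qed.

(** * Independence of the power products of a regular sequence *)

(** The elements of [box r d], the lists of [r] integers below [d], are
    exponents for [power_prod]; lists suit the induction on the sequence. *)
Fixpoint power_prod s (e : seq nat) : R :=
  if (s, e) is (f :: s', i :: e') then f ^+ i * power_prod s' e' else 1.

Fixpoint box (r d : nat) : seq (seq nat) :=
  if r is r'.+1 then [seq i :: e | i <- iota 0 d, e <- box r' d] else [:: [::]].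

Lemma size_box r d : size (box r d) = (d ^ r)%N.
Proof. by elim: r => //= r IHr; rewrite size_allpairs size_iota IHr expnS. Qed.

Lemma box_uniq r d : uniq (box r d).
Proof.
elim: r => //= r IHr; apply: allpairs_uniq => //; first exact: iota_uniq.
by move=> [i e] [j e'] _ _ /= [-> ->].
Qed.

(** The case of a single regular element, for coefficients from a set that
    meets [Q + (f)] only in [0]. *)
Lemma powers_free Q f (G : nat -> R) d :
    ideal_pred Q -> regular_mod Q f -> \sum_(i < d) f ^+ i * G i \in Q ->
    (forall i, (i < d)%N -> G i \in add_elt Q f -> G i = 0) ->
  forall i, (i < d)%N -> G i = 0.
Proof.
move=> Qi regf; elim: d G => // d IHd G; rewrite big_ord_recl mul1r.
have -> : \sum_(i < d) f ^+ lift ord0 i * G (lift ord0 i) =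
    f * \sum_(i < d) f ^+ i * G i.+1.
  by rewrite mulr_sumr; apply: eq_bigr => i _; rewrite exprS mulrA.
move=> Qsum G0; have {}G0_0 : G 0%N = 0.
  apply: G0 => //; apply/add_eltP.
  by eexists _, (- \sum_(i < d) f ^+ i * G i.+1); split; [exact: Qsum | ring].
rewrite G0_0 add0r in Qsum; case=> // i lt_i.
exact: (IHd (fun i => G i.+1) (regf _ Qsum) (fun i => G0 i.+1)).
Qed.

End RegularModIdeal.

Section Independence.
Variables (K : fieldType) (R : comAlgType K).
Implicit Types (Q : {pred R}) (f g v : R) (s : seq R).

(** A relation, reduced modulo the first element [f] of the sequence, only
    keeps its terms free of [f], whose coefficients vanish by induction;
    the other terms are divisible by [f], which may be cancelled as [f] is
    regular. *)
Lemma power_prod_free Q s v d (c : seq nat -> K) :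
  ideal_pred Q -> regular_seq Q s -> v \notin foldl (@add_elt R) Q s ->
  \sum_(e <- box (size s) d) c e *: (power_prod s e * v) \in Q ->
  forall e, e \in box (size s) d -> c e = 0.
Proof.
elim: s Q c => [|f s IHs] Q c Qi /=.
  move=> _ Qv; rewrite big_seq1 mul1r => Qcv e; rewrite inE => /eqP->.
  apply: contraNeq Qv => c0; rewrite -[v](scalerK c0).
  by rewrite -mulr_algl ideal_predM.
move=> [regf regs] Qv; rewrite big_allpairs_dep /=.
have {IHs}IHs := IHs _ _ (add_elt_ideal f Qi) regs Qv.
pose G i := \sum_(e <- box (size s) d) c (i :: e) *: (power_prod s e * v).
have -> : \sum_(i <- iota 0 d) \sum_(e <- box (size s) d)
    c (i :: e) *: (f ^+ i * power_prod s e * v) = \sum_(i < d) f ^+ i * G i.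
  rewrite -[RHS](big_mkord predT (fun i => f ^+ i * G i)) /index_iota subn0.
  apply: eq_bigr => i _; rewrite mulr_sumr; apply: eq_bigr => e _.
  by rewrite -scalerAr mulrA.
move=> /(powers_free Qi regf) G0 _ /allpairsPdep[i [e [Hi He ->]]].
rewrite mem_iota add0n in Hi; apply: (IHs (fun e => c (i :: e)) _ e He).
rewrite -/(G i) G0 //; first by case: (add_elt_ideal f Qi).
move=> {Hi e He} {}i _ QG; rewrite /G big_seq big1 // => e' He'.
by rewrite (IHs (fun e => c (i :: e))) ?scale0r.
Qed.

End Independence.

(** * Monomial ideals *)

Section MonomialIdeals.
Variables (K : fieldType) (n : nat).
Local Notation R := {mpoly K[n]}.
Implicit Types (I : {pred R}) (f g v : R) (m a : 'X_{1..n}) (A Z : {set 'I_n}).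

Lemma msuppMP f g m : m \in msupp (f * g) ->
  exists m1 m2, [/\ m1 \in msupp f, m2 \in msupp g & m = (m1 + m2)%MM].
Proof.
by move/msuppM_le/allpairsP=> -[[m1 m2] /= [H1 H2 ->]]; exists m1, m2.
Qed.

(** For an ideal, this is equivalent to being generated by monomials. *)
Definition supp_determined I : Prop :=
  forall f, (f \in I) <-> {in msupp f, forall m, 'X_[m] \in I}.

Lemma monomial_supp_determined I :
  ideal_pred I -> monomial_ideal I -> supp_determined I.
Proof.
move=> Ii [S IS] f; split=> [/IS[k [c [g [Sg ->]]]] m /msupp_sum_le|].
  case/flattenP=> s /mapP[j _ ->] {s} /msuppMP[m1 [m2 [_]]].
  have [s Ss ->] := Sg j; rewrite msuppX inE => /eqP-> ->.
  rewrite mpolyXD; apply: ideal_predM => //; apply/IS.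
  exists 1%N, (fun=> 1), (fun=> 'X_[s]); rewrite big_ord1 mul1r.
  by split=> // _; exists s.
move=> If; rewrite [f]mpolyE big_seq; apply: ideal_pred_sum => // m Hm.
by rewrite -mul_mpolyC ideal_predM // If.
Qed.

Lemma supp_determinedM I m m' : ideal_pred I ->
  (m <= m')%MM -> 'X_[m] \in I -> 'X_[m'] \in I.
Proof. by move=> Ii /submK<- Im; rewrite mpolyXD ideal_predM. Qed.

Lemma mem_add_power I (i : 'I_n) k m : ideal_pred I -> supp_determined I ->
  ('X_[m] \in add_elt I ('X_i ^+ k)) = ('X_[m] \in I) || (k <= m i)%N.
Proof.
move=> Ii Is; apply/add_eltP/orP => [[g [h [Ig def_m]]]|[Im|le_k]].
- have [|] := boolP (m \in msupp g); first by left; apply: (Is g).1.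
  move=> gm; right; have : m \in msupp (h * 'X_i ^+ k).
    rewrite mcoeff_msupp; have := congr1 (mcoeff m) def_m.
    rewrite mcoeffD (memN_msupp_eq0 gm) add0r mcoeffX eqxx => <-.
    exact: oner_neq0.
  case/msuppMP=> m1 [m2 [_]]; rewrite mpolyXn msuppX inE => /eqP-> ->.
  by rewrite mnmDE mulmnE mnmE eqxx mul1n leq_addl.
- by exists 'X_[m], 0; rewrite mul0r addr0.
exists 0, 'X_[m - U_(i) *+ k]; split; first by case: Ii.
rewrite add0r mpolyXn -mpolyXD submK //; apply/mnm_lepP=> j.
by rewrite mulmnE mnmE; case: eqP => [<-|]; rewrite ?mul1n.
Qed.

(** * Partitions of the monomials outside an ideal *)

(** The monomials in the piece [(a, Z)] form a basis of [x^a K[Z]]. *)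
Definition in_piece (p : 'X_{1..n} * {set 'I_n}) m : bool :=
  [forall i, if i \in p.2 then (p.1 i <= m i)%N else p.1 i == m i].

(** The count says both that the pieces cover the monomials outside [I] and
    that they are disjoint from each other and from [I]. *)
Definition monomial_partition I (D : seq ('X_{1..n} * {set 'I_n})) : Prop :=
  forall m, count (in_piece^~ m) D = ('X_[m] \notin I).

Definition shift_piece (s : 'X_{1..n}) (p : 'X_{1..n} * {set 'I_n}) :=
  ((p.1 + s)%MM, p.2).

Lemma in_shift_piece s p m :
  in_piece (shift_piece s p) m = (s <= m)%MM && in_piece p (m - s)%MM.
Proof.
apply/forallP/andP => [H|[/mnm_lepP le_s /forallP H] i].
  have le_s : (s <= m)%MM.
    apply/mnm_lepP=> i; have:= H i; rewrite /= mnmDE; case: ifP => _.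
      by apply: leq_trans; apply: leq_addl.
    by move/eqP <-; apply: leq_addl.
  split=> //; apply/forallP=> i; have:= H i; rewrite /= mnmDE mnmBE.
  move/mnm_lepP/(_ i): le_s => le_s.
  case: ifP => _; first by rewrite leq_subRL // addnC.
  by rewrite -[in X in _ -> X](eqn_add2r (s i)) subnK.
have:= H i; rewrite /= mnmDE mnmBE; case: ifP => _.
  by rewrite leq_subRL // addnC.
by rewrite -(eqn_add2r (s i)) subnK.
Qed.

(** The exact sequence [0 -> R/(I : x^k) -> R/I -> R/(I + x^k) -> 0] on
    monomials: those outside [I] are outside [I + (x^k)], or multiples by [x^k]
    of monomials outside [I : x^k]. *)
Lemma monomial_partition_cat I (i : 'I_n) k D1 D2 :
  ideal_pred I -> supp_determined I ->
  monomial_partition (add_elt I ('X_i ^+ k)) D1 ->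
  monomial_partition (colon I ('X_i ^+ k)) D2 ->
  monomial_partition I (D1 ++ map (shift_piece (U_(i) *+ k)) D2).
Proof.
move=> Ii Is HD1 HD2 m; rewrite count_cat HD1 count_map.
have le_kE : (U_(i) *+ k <= m)%MM = (k <= m i)%N.
  apply/mnm_lepP/idP => [/(_ i)|le_k j]; rewrite mulmnE mnmE.
    by rewrite eqxx mul1n.
  by case: eqP => [<-|]; rewrite ?mul1n.
rewrite (eq_count (a2 := fun p =>
    (k <= m i)%N && in_piece p (m - U_(i) *+ k)%MM)); last first.
  by move=> p /=; rewrite in_shift_piece le_kE.
rewrite mem_add_power // negb_or -ltnNge.
have [lt_k|le_k] /= := ltnP (m i) k; first by rewrite andbT count_pred0 addn0.
by rewrite andbF HD2 inE mpolyXn -mpolyXD submK ?le_kE.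
Qed.

(** * The primes generated by variables *)

Section VariablePrime.
Variable A : {set 'I_n}.

Definition kill_var (i : 'I_n) : R := if i \in A then 0 else 'X_i.

(** The ideal generated by the variables in [A] is the kernel of the
    substitution of [0] for these variables, hence prime. *)
Definition var_ideal : {pred R} :=
  [pred f | mmap (@mpolyC n K) kill_var f == 0].

Lemma var_ideal_closed : idealr_closed var_ideal.
Proof.
split; rewrite ?inE ?rmorph0 ?rmorph1 ?oner_eq0 //.
move=> a u v; rewrite !inE => /eqP u0 /eqP v0.
by rewrite rmorphD rmorphM /= u0 v0 mulr0 addr0.
Qed.

Lemma var_ideal_prime : prime_idealr_closed var_ideal.
Proof. by move=> u v; rewrite !inE rmorphM mulf_eq0. Qed.

HB.instance Definition _ := isIdealr.Build R var_ideal var_ideal_closed.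
HB.instance Definition _ :=
  isPrimeIdealrClosed.Build R var_ideal var_ideal_prime.

Definition var_prime : prime_idealr R := var_ideal.

Definition mnm_restr m : 'X_{1..n} :=
  [multinom if i \in A then m i else 0%N | i < n].

Lemma mnm_restr_neq0P m :
  reflect (exists2 i, i \in A & m i != 0%N) (mnm_restr m != 0%MM).
Proof.
apply: (iffP idP) => [nz_m|[i Ai nz_mi]].
  have [i] : exists i, mnm_restr m i != 0%N.
    apply/existsP; apply: contraR nz_m; rewrite negb_exists => /forallP m0.
    by apply/eqP/mnmP=> i; have:= m0 i; rewrite negbK mnm0E => /eqP.
  by rewrite mnmE; case: ifP => // Ai nz_mi; exists i.
by apply: contraNneq nz_mi => /mnmP/(_ i); rewrite mnmE Ai mnm0E => ->.
Qed.

Lemma kill_varX m :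
  mmap (@mpolyC n K) kill_var 'X_[m] =
  if mnm_restr m == 0%MM then 'X_[m] else 0.
Proof.
rewrite mmapX /mmap1; have [m0|/mnm_restr_neq0P[i Ai nz_mi]] := eqVneq.
  rewrite mpolyXE_id; apply: eq_bigr => i _.
  rewrite /kill_var; case: ifP => // Ai.
  by have /mnmP/(_ i) := m0; rewrite mnmE Ai mnm0E => ->; rewrite !expr0.
by rewrite (bigD1 i) //= /kill_var Ai expr0n (negPf nz_mi) mul0r.
Qed.

Lemma kill_varE f : mmap (@mpolyC n K) kill_var f =
  \sum_(m <- msupp f | mnm_restr m == 0%MM) f@_m *: 'X_[m].
Proof.
rewrite [f in LHS]mpolyE rmorph_sum /= [RHS]big_mkcond; apply: eq_bigr => m _.
by rewrite mmapZ kill_varX mul_mpolyC; case: ifP; rewrite ?scaler0.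
Qed.

End VariablePrime.

(** * Stanley decompositions of primary quotients *)

Section Primary.
Variable I : {pred R}.
Hypotheses (Iprim : primary_ideal I) (Is : supp_determined I).

Let Ii : ideal_pred I. Proof. by case: Iprim => /idealr_pred. Qed.

Let I1 : 1 \notin I. Proof. by case: Iprim => -[]. Qed.

Definition radical_vars : {set 'I_n} :=
  [set i | boolp.asbool (in_radical I 'X_i)].
Local Notation A := radical_vars.

Lemma radical_varsP i : reflect (in_radical I 'X_i) (i \in A).
Proof. by rewrite inE; apply: boolp.asboolP. Qed.

Lemma restr_le m : (mnm_restr A m <= m)%MM.
Proof. by apply/mnm_lepP=> i; rewrite mnmE; case: ifP. Qed.

(** A primary ideal contains [f x_i] only if it contains [f] or a power of
    [x_i], so the variables outside the radical can be cancelled. *)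
Lemma mem_primary_restr m : ('X_[m] \in I) = ('X_[mnm_restr A m] \in I).
Proof.
apply/idP/idP; last exact: supp_determinedM (restr_le m).
rewrite -{1}(submK (restr_le m)) mpolyXD mulrC.
move: 'X_[mnm_restr A m]; rewrite mpolyXE_id.
apply: (big_ind (fun g => forall f, f * g \in I -> f \in I))
  => [f|g h Hg Hh f|i _ f].
- by rewrite mulr1.
- by rewrite mulrA => /Hh /Hg.
rewrite mnmBE mnmE; case: ifPn => [_|nAi]; first by rewrite subnn mulr1.
rewrite subn0; elim: (m i) => [|k IHk]; first by rewrite mulr1.
rewrite exprSr mulrA => /(proj2 Iprim)[]// rad_i.
by case/radical_varsP: nAi.
Qed.

(** A variable of the radical has a power in [I], which bounds its exponent. *)
Lemma primary_degree_bound : exists d : nat, forall m,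
  'X_[m] \notin I -> (mdeg (mnm_restr A m) < d)%N.
Proof.
have /fin_all_exists[e He] i : exists e, i \in A -> 'X_i ^+ e \in I.
  have [[e Ie]|nAi] := radical_varsP i; first by exists e.
  by exists 0%N.
exists (\sum_i e i).+1 => m; rewrite mem_primary_restr => nIm.
rewrite ltnS mdegE leq_sum // => i _; apply: contraNT nIm; rewrite -ltnNge mnmE.
case: ifP => // Ai lt_e; apply: (@supp_determinedM _ (U_(i) *+ e i)) => //.
  apply/mnm_lepP=> j; rewrite mulmnE !mnmE.
  by case: eqP => [<-|_]; rewrite ?mul0n // Ai mul1n ltnW.
by rewrite -mpolyXn He.
Qed.

Lemma restr_idem m : mnm_restr A (mnm_restr A m) = mnm_restr A m.
Proof. by apply/mnmP=> i; rewrite !mnmE; case: (i \in A). Qed.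

Lemma primary_partition : exists D, monomial_partition I D /\
  {in D, forall p, p.2 = ~: A}.
Proof.
have [b Hb] := primary_degree_bound.
pose L := [seq a <- [seq val x | x <- enum {: 'X_{1..n < b}}] |
            (mnm_restr A a == a) && ('X_[a] \notin I)].
exists [seq (a, ~: A) | a <- L]; split=> [m|p /mapP[a _ ->]//].
rewrite count_map (eq_in_count (a2 := pred1 (mnm_restr A m))); last first.
  move=> a; rewrite mem_filter => /andP[/andP[/eqP aA _] _] /=.
  apply/forallP/eqP => [H|-> i].
    apply/mnmP=> i; rewrite -[in LHS]aA !mnmE; case: ifP => // Ai.
    by have := H i; rewrite /= inE Ai => /eqP.
  by rewrite /= inE mnmE; case: (i \in A) => /=.
rewrite count_uniq_mem; last first.
  by rewrite filter_uniq // map_inj_uniq ?enum_uniq //; apply: val_inj.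
congr nat_of_bool; rewrite mem_filter restr_idem eqxx /= -mem_primary_restr.
case: (boolP ('X_[m] \in I)) => //= nIm.
by apply/mapP; exists (BMultinom (Hb m nIm)); rewrite ?mem_enum.
Qed.

(** Take for [v] a monomial outside [I] of maximal degree in the variables in
    [A]: multiplication by such a variable raises this degree. *)
Lemma primary_socle :
  exists2 v, v \notin I & forall i, i \in A -> 'X_i * v \in I.
Proof.
have [b Hb] := primary_degree_bound.
pose P d :=
  boolp.asbool (exists2 a, 'X_[a] \notin I & mdeg (mnm_restr A a) = d).
have exP : exists d, P d.
  exists (mdeg (mnm_restr A 0%MM)); apply/boolp.asboolP.
  by exists 0%MM; rewrite ?mpolyX0.
have leP d : P d -> (d <= b)%N by case/boolp.asboolP=> a /Hb /ltnW le_b <-.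
have [d /boolp.asboolP[a nIa def_d] maxd] := ex_maxnP exP leP.
exists 'X_[a] => // i Ai; apply: contraT; rewrite -mpolyXD => nIia.
have /maxd : P (mdeg (mnm_restr A (U_(i) + a)%MM)).
  by apply/boolp.asboolP; exists (U_(i) + a)%MM.
have -> : mnm_restr A (U_(i) + a)%MM = (U_(i) + mnm_restr A a)%MM.
  apply/mnmP=> j; rewrite !mnmE; case: ifP => // nAj.
  by case: eqP => // eij; rewrite eij nAj in Ai.
by rewrite mdegD mdeg1 def_d ltnn.
Qed.

Lemma primary_kill f : f \in I -> f \in var_ideal A.
Proof.
move=> If; rewrite inE kill_varE big_seq_cond big1 // => m /andP[Hm /eqP m0].
have := (Is f).1 If m Hm; rewrite mem_primary_restr m0 mpolyX0.
by rewrite (negPf I1).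
Qed.

(** The prime is the annihilator of the element [v] of [primary_socle]: if
    [g v] is in [I] then [g] is in the radical of [I], as [I] is primary, and
    hence in each prime that contains [I]. *)
Lemma primary_associated : associated_prime I (var_prime A).
Proof.
have [v nIv Iv] := primary_socle; exists v => g; rewrite [RHS]inE.
apply/idP/idP => [|Igv].
  rewrite inE kill_varE => /eqP kill_g.
  rewrite [g]mpolyE (bigID (fun m => mnm_restr A m == 0%MM)) /= kill_g add0r.
  rewrite mulr_suml; apply: ideal_pred_sum => // m nz_m.
  rewrite -scalerAl -mul_mpolyC ideal_predM //.
  have /mnm_restr_neq0P[i Ai nz_mi] := nz_m.
  rewrite -(submK (m := U_(i)%MM) (m' := m)) ?lep1mP // mpolyXD -mulrA.
  by apply: ideal_predM; rewrite ?Iv.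
move: Igv; rewrite mulrC => /(proj2 Iprim)[|[k /primary_kill]].
  by rewrite (negPf nIv).
by rewrite inE rmorphXn expf_eq0 => /andP[].
Qed.

End Primary.

(** * Partitions for ass-decomposable ideals *)

(** Associated primes, rather than their sets of variables, are kept along the
    induction: condition (i) transfers them from [I + (x^k)] to [I]. *)
Lemma ass_decomposable_partition I : ass_decomposable I ->
  exists D, monomial_partition I D /\
    forall q, q \in D -> exists2 p : prime_idealr R,
      associated_prime I p & forall i, i \notin q.2 -> 'X_i \in p.
Proof.
elim=> {I} [I Im Iprim|I i k Icl Im _ _ assD _ [D1 [HD1 PD1]] _ [D2 [HD2 PD2]]].
  have Is := monomial_supp_determined (idealr_pred (proj1 Iprim)) Im.
  have [D [HD HZ]] := primary_partition Iprim; exists D; split=> // q /HZ->.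
  exists (var_prime (radical_vars I)); first exact: primary_associated.
  move=> i; rewrite inE negbK => Ai; rewrite inE kill_varX.
  rewrite ifN //; apply/mnm_restr_neq0P; exists i => //.
  by rewrite mnmE eqxx.
have Ii := idealr_pred Icl; have Is := monomial_supp_determined Ii Im.
exists (D1 ++ map (shift_piece (U_(i) *+ k)) D2); split.
  exact: monomial_partition_cat.
move=> q; rewrite mem_cat => /orP[/PD1[p /assD[assp _] Hp]|]; first by exists p.
case/mapP=> q' /PD2[p [f Hf] Hp] ->; exists p => //.
by exists (f * 'X_i ^+ k) => g; rewrite Hf !inE mulrA.
Qed.

End MonomialIdeals.
Arguments in_piece {n}.

Section QuotientPi.
Variables (R : comNzRingType) (I : idealr R).

Lemma idealr_ideal_pred : ideal_pred I.
Proof.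
by split=> [|a u v Iu Iv]; [exact: idealr0 | rewrite rpredD // idealMr].
Qed.

Lemma pi_eq0 f : (\pi_{ideal_quot I} f == 0) = (f \in I).
Proof. by rewrite -(rmorph0 (\pi_{ideal_quot I})) -Quotient.idealrBE subr0. Qed.

Lemma scale_pi a f : a *: \pi_{ideal_quot I} f = \pi_{ideal_quot I} (a * f).
Proof. by rewrite rmorphM. Qed.

End QuotientPi.

(** * From partitions to Stanley decompositions *)

Section Stanley.
Variables (K : fieldType) (n : nat) (I : idealr {mpoly K[n]}).
Local Notation R := {mpoly K[n]}.
Hypothesis Is : supp_determined I.
Variable D : seq ('X_{1..n} * {set 'I_n}).
Hypothesis HD : monomial_partition I D.
Local Notation pi := (\pi_{ideal_quot I}).
Implicit Types (f g : R) (m : 'X_{1..n}).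

Let piece_mnm (j : 'I_(size D)) := (tnth (in_tuple D) j).1.
Let piece_vars (j : 'I_(size D)) := (tnth (in_tuple D) j).2.
Let gen (j : 'I_(size D)) : {ideal_quot I} := pi 'X_[piece_mnm j].

Lemma subpolyP (Z : {set 'I_n}) f : reflect
  (forall m, m \in msupp f -> forall i, m i != 0%N -> i \in Z)
  (f \in subpoly Z).
Proof.
apply: (iffP allP) => [H m /H /forallP Hm i|H m Hm].
  by apply/implyP.
by apply/forallP=> i; apply/implyP; apply: H.
Qed.

Lemma in_piece_add j f m : f \in subpoly (piece_vars j) -> m \in msupp f ->
  in_piece (tnth (in_tuple D) j) (piece_mnm j + m)%MM.
Proof.
move=> /subpolyP Hf /Hf Hm; apply/forallP=> i; rewrite mnmDE -/(piece_vars j).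
case: ifPn => [_|]; first exact: leq_addr.
apply: contraR => nz; apply: Hm; apply: contra nz => /eqP->.
by rewrite addn0.
Qed.

Lemma in_piece_notin j m : in_piece (tnth (in_tuple D) j) m -> 'X_[m] \notin I.
Proof.
move=> Hm; suffices: has (in_piece^~ m) D by rewrite has_count HD lt0b.
apply/hasP.
by exists (tnth (in_tuple D) j) => //; apply: mem_tnth.
Qed.

Lemma sum_in_piece m :
  (\sum_j in_piece (tnth (in_tuple D) j) m)%N = ('X_[m] \notin I).
Proof.
rewrite -HD -sum1_count [RHS]big_tnth [RHS]big_mkcond /=.
by apply: eq_bigr => j _; case: (in_piece _ m).
Qed.

Lemma in_piece_inj j j' m : in_piece (tnth (in_tuple D) j) m ->
  in_piece (tnth (in_tuple D) j') m -> j = j'.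
Proof.
move=> Hj Hj'; apply/eqP; apply: contraT => ne_jj'.
have := sum_in_piece m; rewrite (bigD1 j) //= (bigD1 j') 1?eq_sym //= Hj Hj'.
by case: (_ \notin _).
Qed.

Lemma in_piece_sub j m : in_piece (tnth (in_tuple D) j) m ->
  (piece_mnm j <= m)%MM /\
  ('X_[m - piece_mnm j] : R) \in subpoly (piece_vars j).
Proof.
move/forallP=> Hm; split.
  apply/mnm_lepP=> i; have:= Hm i; rewrite -/(piece_mnm j).
  by case: ifP => // _ /eqP->.
apply/subpolyP=> m'; rewrite msuppX inE => /eqP-> i; rewrite mnmBE.
have:= Hm i; rewrite -/(piece_vars j) -/(piece_mnm j).
by case: ifP => // _ /eqP->; rewrite subnn.
Qed.

Lemma subpolyB Z f g :
  f \in subpoly Z -> g \in subpoly Z -> f - g \in subpoly Z.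
Proof.
move=> /subpolyP Hf /subpolyP Hg; apply/subpolyP=> m /msuppB_le.
by rewrite mem_cat => /orP[/Hf|/Hg].
Qed.

(** A monomial of [h j * x^a] is outside [I] and in no other piece, so it
    occurs in the sum, contradicting that the sum is in [I]. *)
Lemma partition_stanley_direct (h : 'I_(size D) -> R) :
  (forall j, h j \in subpoly (piece_vars j)) ->
  \sum_j h j * 'X_[piece_mnm j] \in I -> forall j, h j = 0.
Proof.
move=> hZ Ih j; apply/eqP; rewrite -msupp_eq0.
case def_s: (msupp _) => [//|m s].
have hm : m \in msupp (h j) by rewrite def_s mem_head.
have Hm := in_piece_add (hZ j) hm.
case/negP: (in_piece_notin Hm); apply: ((Is _).1 Ih).
rewrite mcoeff_msupp raddf_sum (bigD1 j) //= mcoeffMX.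
rewrite big1 ?addr0 -?mcoeff_msupp //.
move=> j' ne_j'; apply/eqP; rewrite mcoeff_eq0; apply: contra ne_j'.
case/msuppMP=> m1 [m2 [Hm1]]; rewrite msuppX inE => /eqP-> E; apply/eqP.
by apply: (in_piece_inj _ Hm); rewrite E addmC; apply: in_piece_add.
Qed.

Let part f j : R :=
  \sum_(m <- msupp f | in_piece (tnth (in_tuple D) j) m) f@_m *: 'X_[m].

Lemma part_multiple f j :
  exists2 h, h \in subpoly (piece_vars j) & part f j = h * 'X_[piece_mnm j].
Proof.
exists (\sum_(m <- msupp f | in_piece (tnth (in_tuple D) j) m)
          f@_m *: 'X_[m - piece_mnm j]).
  apply/subpolyP=> m /msupp_sum_le /flattenP[s /mapP[m' Hm' ->] /msuppZ_le].
  move: Hm'; rewrite mem_filter => /andP[/in_piece_sub[_ /subpolyP H] _].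
  exact: H.
rewrite mulr_suml; apply: eq_bigr => m.
by case/in_piece_sub=> le_m _; rewrite -scalerAl -mpolyXD submK.
Qed.

Lemma partition_stanley_span f : f - \sum_j part f j \in I.
Proof.
apply/Is=> m; rewrite mcoeff_msupp; apply: contraR => nIm.
rewrite mcoeffB raddf_sum /=.
have -> : \sum_j (part f j)@_m =
    \sum_j f@_m *+ in_piece (tnth (in_tuple D) j) m.
  apply: eq_bigr => j _; rewrite /part -big_filter raddf_sum /=.
  set F := filter _ _; have [Hm|/negPf Hm] := boolP (m \in F).
    rewrite (bigD1_seq m) //= ?filter_uniq ?msupp_uniq //.
    rewrite mcoeffZ mcoeffX eqxx mulr1.
    rewrite big1 ?addr0 => [|m' /negPf ne]; last first.
      by rewrite mcoeffZ mcoeffX ne mulr0.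
    by move: Hm; rewrite mem_filter => /andP[->].
  rewrite big_seq big1 => [|m' Hm']; last first.
    by rewrite mcoeffZ mcoeffX; case: eqP Hm' => [->|]; rewrite ?Hm ?mulr0.
  move: Hm; rewrite mem_filter; case: (in_piece _ _) => //= /negbT.
  by move/memN_msupp_eq0->; rewrite mul0rn.
by rewrite sumrMnr sum_in_piece nIm mulr1n subrr.
Qed.

Lemma partition_stanley :
  stanley_decomposition (@quot_piece K n I) gen piece_vars.
Proof.
split=> [j|j f Hf|v].
- exists (\row_i (piece_mnm j i)%:Z), 'X_[piece_mnm j] => // m.
  by rewrite msuppX inE => /eqP-> i; rewrite mxE.
- rewrite scale_pi => /eqP; rewrite pi_eq0 => If.
  pose h j' := if j' == j then f else 0.
  rewrite -(partition_stanley_direct (h := h) _ _ j) /h ?eqxx // => [j'|].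
    by case: eqP => [->//|_]; apply/subpolyP=> m; rewrite msupp0.
  rewrite (bigD1 j) //= eqxx big1 ?addr0 // => j' /negPf->.
  by rewrite mul0r.
exists [ffun j => pi (part (repr v) j)]; split.
  split=> [j|].
    have [h hZ def_part] := part_multiple (repr v) j.
    by exists h; rewrite ?ffunE ?def_part ?scale_pi.
  apply/eqP; rewrite -[X in X == _]reprK.
  under eq_bigr do rewrite ffunE.
  by rewrite -rmorph_sum -Quotient.idealrBE partition_stanley_span.
move=> w [Hw def_v]; apply/ffunP=> j.
have /fin_all_exists2[h hZ wE] j' :
    exists2 f, f \in subpoly (piece_vars j') & w j' = f *: gen j'.
  by case: (Hw j') => f; exists f.
have /fin_all_exists2[h' hZ' wE'] := part_multiple (repr v).
rewrite ffunE wE wE' scale_pi; congr (pi (_ * _)).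
apply/eqP; rewrite -subr_eq0; apply/eqP.
apply: (partition_stanley_direct (h := fun j => h' j - h j)) => [j'|].
  exact: subpolyB.
rewrite -pi_eq0.
have -> : \sum_j' (h' j' - h j') * 'X_[piece_mnm j'] =
   \sum_j' part (repr v) j' - \sum_j' h j' * 'X_[piece_mnm j'].
  by rewrite -sumrB; apply: eq_bigr => j' _; rewrite wE' mulrBl.
rewrite rmorphB subr_eq0 [X in _ == X]rmorph_sum.
have <- : v = \sum_j' pi (h j' * 'X_[piece_mnm j']).
  by rewrite def_v; apply: eq_bigr => j' _; rewrite wE scale_pi.
rewrite eq_sym -[X in X == _]reprK -Quotient.idealrBE.
exact: partition_stanley_span.
Qed.

End Stanley.

(** * The depth of a quotient by a monomial ideal *)

Section RegularSequences.
Variables (R : comNzRingType) (I : idealr R).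

Lemma in_prefix_spanE r (f : 'I_r -> R) (i : nat) (g : R) : (i <= r)%N ->
  in_prefix_span f i (\pi_{ideal_quot I} g) <->
  g \in foldl (@add_elt R) I (take i (codom f)).
Proof.
elim: i g => [|i IHi] g le_i.
  rewrite take0 /= -pi_eq0; split=> [[w]|/eqP->].
    by rewrite big_pred0 // => ->.
  by exists (fun=> 0); rewrite big_pred0.
pose o := Ordinal le_i.
have -> : take i.+1 (codom f) = rcons (take i (codom f)) (f o).
  rewrite (take_nth 0) ?size_codom ?card_ord //; congr rcons.
  have {1}-> : i = enum_rank o by rewrite enum_rank_ord.
  by rewrite nth_codom enum_rankK.
rewrite foldl_rcons.
have sumE (w : 'I_r -> {ideal_quot I}) :
    \sum_(j < r | (j < i.+1)%N) f j *: w j =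
    f o *: w o + \sum_(j < r | (j < i)%N) f j *: w j.
  rewrite (bigD1 o) ?ltnSn //=; congr (_ + _); apply: eq_bigl => j.
  by rewrite -val_eqE /= ltnS [RHS]ltn_neqAle andbC.
split=> [[w Hw]|/add_eltP[a [b [Ha ->]]]].
  apply/add_eltP; exists (g - repr (w o) * f o), (repr (w o)).
  split; last by rewrite subrK.
  apply/(IHi _ (ltnW le_i)); exists w.
  rewrite rmorphB /= Hw sumE rmorphM /= reprK [X in _ - X]mulrC.
  by rewrite addrAC subrr add0r.
have [w Hw] := (IHi _ (ltnW le_i)).2 Ha.
exists (fun j => if j == o then \pi b else w j).
rewrite sumE eqxx rmorphD /= Hw addrC scale_pi [b * _]mulrC; congr (_ + _).
by apply: eq_bigr => j lt_j; rewrite -val_eqE ltn_eqF.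
Qed.

Lemma regular_seqP (Q : {pred R}) s :
  (forall i, (i < size s)%N ->
     regular_mod (foldl (@add_elt R) Q (take i s)) (nth 0 s i)) ->
  regular_seq Q s.
Proof.
elim: s Q => //= f s IHs Q H; split; first exact: (H 0%N).
by apply: IHs => i; apply: (H i.+1).
Qed.

Lemma regular_sequence_seq r (f : 'I_r -> R) :
  regular_sequence {ideal_quot I} f -> regular_seq I (codom f).
Proof.
case=> regf _; apply: regular_seqP => i; rewrite size_codom card_ord => lt_i v.
have -> : nth 0 (codom f) i = f (Ordinal lt_i).
  have {1}-> : i = enum_rank (Ordinal lt_i) by rewrite enum_rank_ord.
  by rewrite nth_codom enum_rankK.
move/(in_prefix_spanE _ _ (ltnW lt_i)); rewrite -scale_pi.
by move/(regf (Ordinal lt_i))/(in_prefix_spanE _ _ (ltnW lt_i)).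
Qed.

End RegularSequences.

Section DepthBound.
Variables (K : fieldType) (n : nat).
Local Notation R := {mpoly K[n]}.
Implicit Types (f g v : R) (m : 'X_{1..n}) (s : seq R).

Definition order_ge d f := forall m, m \in msupp f -> (d <= mdeg m)%N.
Definition degree_le d f := forall m, m \in msupp f -> (mdeg m <= d)%N.

Lemma order_geM d e f g :
  order_ge d f -> order_ge e g -> order_ge (d + e) (f * g).
Proof.
move=> Hf Hg m /msuppMP[m1 [m2 [/Hf H1 /Hg H2 ->]]].
by rewrite mdegD leq_add.
Qed.

Lemma degree_leM d e f g :
  degree_le d f -> degree_le e g -> degree_le (d + e) (f * g).
Proof.
move=> Hf Hg m /msuppMP[m1 [m2 [/Hf H1 /Hg H2 ->]]].
by rewrite mdegD leq_add.
Qed.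

Lemma order_geX d f : order_ge 1 f -> order_ge d (f ^+ d).
Proof.
move=> Hf; elim: d => [|d IHd] //; rewrite exprS.
exact: (order_geM Hf IHd).
Qed.

Lemma degree_le1 : degree_le 0 1.
Proof. by move=> m; rewrite msupp1 inE => /eqP->; rewrite mdeg0. Qed.

Lemma degree_leX d e f : degree_le d f -> degree_le (e * d) (f ^+ e).
Proof.
move=> Hf; elim: e => [|e IHe]; first exact: degree_le1.
by rewrite exprS mulSn; apply: degree_leM.
Qed.

Lemma degree_le_power_prod d B s e : {in s, forall f, degree_le B f} ->
  e \in box (size s) d -> degree_le (size s * (d * B)) (power_prod s e).
Proof.
elim: s e => [|f s IHs] e Hs; first by rewrite inE => /eqP->; apply: degree_le1.
case/allpairsPdep=> i [e' [Hi He' ->]] /=; rewrite mulSn.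
apply: degree_leM; last first.
  by apply: IHs => // g sg; apply: Hs; rewrite inE sg orbT.
move=> m /(degree_leX (Hs f (mem_head _ _))) le_m; apply: leq_trans le_m _.
by rewrite mem_iota in Hi; rewrite leq_mul2r ltnW ?orbT.
Qed.

Lemma irrelevant_order f : irrelevant_ideal K n f -> order_ge 1 f.
Proof.
case=> k [c [g [Hg ->]]] m /msupp_sum_le /flattenP[s /mapP[j _ ->]].
have [i ->] := Hg j; case/msuppMP=> m1 [m2 [_]].
by rewrite msuppX inE => /eqP-> ->; rewrite mdegD mdeg1 addn1.
Qed.

(** Krull's intersection theorem for a monomial ideal: modulo an ideal
    [(s)] contained in a high power of the maximal ideal, the terms of low
    degree do not change. *)
Lemma notin_foldl_high (I : {pred R}) s v : ideal_pred I -> supp_determined I ->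
  {in s, forall f, order_ge (msize v) f} -> v \notin I ->
  v \notin foldl (@add_elt R) I s.
Proof.
move=> Ii Is Hs; apply: contra => Jv.
suffices [a Ia Ha] : exists2 a, a \in I & order_ge (msize v) (v - a).
  apply/Is=> m vm; apply: ((Is a).1 Ia); rewrite mcoeff_msupp.
  suffices <- : v@_m = a@_m by rewrite -mcoeff_msupp.
  apply/eqP; rewrite -subr_eq0 -mcoeffB mcoeff_eq0.
  by apply/negP=> /Ha; rewrite leqNgt msize_mdeg_lt.
have : forall g, g \in I -> exists2 a, a \in I & order_ge (msize v) (g - a).
  by move=> g Ig; exists g; rewrite // subrr => m; rewrite msupp0.
elim: s {1 2}I Hs Jv {Ii Is} => [|f s IHs] Q Hs /=; first by move=> Qv; apply.
move=> Jv HQ; apply: IHs Jv _ => [g sg|g /add_eltP[a [b [/HQ[a' Ia' Ha'] ->]]]].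
  by apply: Hs; rewrite inE sg orbT.
exists a' => // m; rewrite addrAC => /msuppD_le; rewrite mem_cat.
case/orP=> [/Ha'//|]; have Hf := Hs f (mem_head _ _).
by move/(order_geM (d := 0) (fun _ _ => leq0n _) Hf).
Qed.

(** Reduction modulo the prime generated by the variables outside [Z] keeps the
    coefficients at monomials in the variables in [Z].  Those with exponents at
    most [d] form a matrix with linearly independent rows, and the number of
    its columns is the right-hand side. *)
Lemma free_mod_vars_bound (Z : {set 'I_n}) d N (P : 'I_N -> R) :
  (forall i, degree_le d (P i)) ->
  (forall c : 'I_N -> K,
     (forall m, (forall j, j \notin Z -> m j = 0%N) ->
        (\sum_i c i *: P i)@_m = 0) -> forall i, c i = 0) ->
  (N <= d.+1 ^ #|Z|)%N.
Proof.
move=> Pd Pfree.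
pose T := {ffun {j | j \in Z} -> 'I_d.+1}.
pose mn (e : T) : 'X_{1..n} :=
  [multinom if insub j is Some z then val (e z) else 0%N | j < n].
have -> : (d.+1 ^ #|Z|)%N = #|{: T}| by rewrite card_ffun card_ord card_sig.
pose M : 'M[K]_(N, #|{: T}|) := \matrix_(i, e) (P i)@_(mn (enum_val e)).
suffices /eqP <- : row_free M by apply: rank_leq_col.
apply: inj_row_free => u uM; apply/rowP=> i; rewrite mxE.
apply: (Pfree (u 0)) => m mZ.
have [le_m|] := boolP [forall j, (m j <= d)%N]; last first.
  rewrite negb_forall => /existsP[j]; rewrite -ltnNge => lt_d.
  rewrite raddf_sum big1 // => i' _.
  rewrite /= mcoeffZ memN_msupp_eq0 ?mulr0 //.
  apply/negP=> /Pd; rewrite leqNgt; case/negP; apply: leq_trans lt_d _.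
  by rewrite mdegE (bigD1 j) //= leq_addr.
pose e : T := [ffun z => inord (m (val z))].
have mn_e : mn e = m.
  apply/mnmP=> j; rewrite mnmE; case: insubP => [z _ <-|/mZ->//].
  by rewrite ffunE /= inordK // ltnS (forallP le_m).
have := congr1 (fun A : 'rV_ _ => A 0 (enum_rank e)) uM; rewrite !mxE => <-.
rewrite raddf_sum; apply: eq_bigr => i' _.
by rewrite /= mcoeffZ mxE enum_rankK mn_e.
Qed.

Lemma expn_growth z r C : (forall d, d ^ r <= (d * C).+1 ^ z)%N -> (r <= z)%N.
Proof.
move=> H; rewrite leqNgt; apply/negP=> lt_zr.
pose d := (C.+1 ^ z).+1.
have : (d ^ z.+1 <= d ^ z * C.+1 ^ z)%N.
  apply: (@leq_trans (d ^ r)); first by rewrite leq_pexp2l.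
  apply: leq_trans (H d) _; rewrite -expnMn.
  have le_d : ((d * C).+1 <= d * C.+1)%N.
    by rewrite mulnS addnC -addn1 leq_add2l.
  by case: (z) => // z'; rewrite leq_exp2r.
by rewrite expnSr leq_pmul2l ?expn_gt0 // /d ltnn.
Qed.

(** Multiplication by [v] induces a map to [R/I] from [R/p], for the prime [p]
    generated by the variables outside [Z], so independence of the multiples of
    [v] modulo [I] yields independence modulo [p].  High powers of the [f i] are
    used to keep [v] out of the ideal that they generate together with [I]. *)
Lemma regular_sequence_bound (I : idealr R) r (f : 'I_r -> R)
    (Z : {set 'I_n}) v :
  supp_determined I -> (forall i, irrelevant_ideal K n (f i)) ->
  regular_sequence {ideal_quot I} f ->
  v \notin I -> (forall i, i \notin Z -> v * 'X_i \in I) ->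
  (r <= #|Z|)%N.
Proof.
move=> Is fm /regular_sequence_seq regf nIv Iv.
have Ii := idealr_ideal_pred I.
pose s := [seq g ^+ (msize v).+1 | g <- codom f].
have size_s : size s = r by rewrite size_map size_codom card_ord.
have regs : regular_seq I s := regular_seq_expr _ Ii regf.
have nJv : v \notin foldl (@add_elt R) I s.
  apply: notin_foldl_high => // _ /mapP[_ /codomP[i ->] ->] m /order_geX.
  by move=> /(_ (irrelevant_order (fm i)))/ltnW.
pose B := \max_(g <- s) msize g.
have sB : {in s, forall g, degree_le B g}.
  move=> g sg m gm.
  exact: leq_trans (ltnW (msize_mdeg_lt gm)) (leq_bigmax_seq _ sg _).
apply: (@expn_growth _ _ (r * B)) => d.
rewrite -(size_box r d) mulnCA.
pose P (i : 'I_(size (box r d))) := power_prod s (nth [::] (box r d) i).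
apply: (free_mod_vars_bound (P := P)).
  move=> i; rewrite -[in X in degree_le X]size_s.
  by apply: degree_le_power_prod; rewrite // size_s mem_nth.
move=> c c0 i.
pose x e := if insub (index e (box r d)) is Some i then c i else 0.
have xE (j : 'I_(size (box r d))) : x (nth [::] (box r d) j) = c j.
  by rewrite /x index_uniq ?box_uniq // valK.
rewrite -xE; apply: (power_prod_free (d := d) Ii regs nJv); last first.
  by rewrite size_s mem_nth.
rewrite size_s (big_nth [::]) big_mkord.
pose g := \sum_i c i *: P i.
have -> : \sum_(i < size (box r d)) x (nth [::] (box r d) i) *:
   (power_prod s (nth [::] (box r d) i) * v) = g * v.
  by rewrite mulr_suml; apply: eq_bigr => j _; rewrite xE scalerAl.
rewrite [g]mpolyE mulr_suml big_seq; apply: ideal_pred_sum => // m gm.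
rewrite -scalerAl -mul_mpolyC ideal_predM //.
have [j nZj nz_mj] : exists2 j, j \notin Z & m j != 0%N.
  apply/exists_inP; apply: contraLR gm => /exists_inPn mZ.
  rewrite -mcoeff_eq0; apply/eqP/c0 => j /mZ; rewrite negbK.
  by move/eqP.
rewrite -(submK (m := U_(j)%MM) (m' := m)) ?lep1mP // mpolyXD -mulrA.
by apply: ideal_predM; rewrite // mulrC Iv.
Qed.

End DepthBound.

Lemma is_max_exists (P : nat -> Prop) a b :
  P a -> (forall d, P d -> (d <= b)%N) -> exists d, is_max P d.
Proof.
move=> Pa Pb; pose p d := boolp.asbool (P d).
have exp : exists d, p d by exists a; apply/boolp.asboolP.
have pb d : p d -> (d <= b)%N by move/boolp.asboolP/Pb.
have [d /boolp.asboolP Pd maxd] := ex_maxnP exp pb.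
by exists d; split=> // e Pe; apply: maxd; apply/boolp.asboolP.
Qed.

Theorem corollary3p7 (K : fieldType) (n : nat) (I : idealr {mpoly K[n]}) :
  monomial_ideal I -> unmixed I -> ass_decomposable I ->
  exists s d : nat,
    [/\ is_sdepth (@quot_piece K n I) s,
        is_depth {ideal_quot I} (irrelevant_ideal K n) d
      & (d <= s)%N].
Proof.
move=> Im _ Iad.
have Is := monomial_supp_determined (idealr_ideal_pred I) Im.
have [D [HD Dprime]] := ass_decomposable_partition Iad.
have nI1 : 'X_[0] \notin I by rewrite mpolyX0 idealr1.
have bound q r (f : 'I_r -> {mpoly K[n]}) : q \in D ->
    (forall i, irrelevant_ideal K n (f i)) ->
    regular_sequence {ideal_quot I} f -> (r <= #|q.2|)%N.
  move=> /Dprime[p [v Hv] Hp] fm regf.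
  apply: (regular_sequence_bound (v := v) Is fm regf) => [|i /Hp].
    by have := idealr1 p; rewrite [_ \in p]Hv inE mul1r => ->.
  by rewrite Hv inE mulrC.
pose t := \big[minn/n]_(j < size D) #|(tnth (in_tuple D) j).2|.
have stan_t : exists m (u : 'I_m -> {ideal_quot I}) (Z : 'I_m -> {set 'I_n}),
    stanley_decomposition (@quot_piece K n I) u Z /\
    t = \big[minn/n]_(j < m) #|Z j|.
  have stanD := partition_stanley Is HD.
  by eexists _, _, _; split; [exact: stanD|].
have [s sP] : exists s, is_sdepth (@quot_piece K n I) s.
  apply: (is_max_exists (b := n) stan_t).
  move=> _ [m [u [Z [_ ->]]]]; elim/big_ind: _ => // [x y lex _|j _].
    exact: leq_trans (geq_minl _ _) lex.
  by rewrite -[X in (_ <= X)%N]card_ord max_card.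
(* the piece that contains the monomial 1 shows that D is not empty *)
have /hasP[q0 Dq0 _] : has (in_piece^~ 0%MM) D by rewrite has_count HD nI1.
have [d dP] : exists d, is_depth {ideal_quot I} (irrelevant_ideal K n) d.
  apply: (is_max_exists (a := 0%N) (b := #|q0.2|)).
    exists (fun=> 0); split=> [[]//|]; split=> [[]//|].
    exists 1 => -[w]; rewrite big_ord0 => /eqP.
    by rewrite oner_eq0.
  by move=> r [f [fm regf]]; apply: bound regf.
exists s, d; split=> //; have [[f [fm regf]] _] := dP.
have le_d q : q \in D -> (d <= #|q.2|)%N by move=> Dq; apply: bound regf.
have [_ max_s] := sP; apply: leq_trans (max_s t stan_t).
rewrite /t; elim/big_ind: _ => [|x y lex ley|j _].
- apply: leq_trans (le_d _ Dq0) _.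
  by rewrite -[X in (_ <= X)%N]card_ord max_card.
- by rewrite leq_min lex.
by apply: le_d; apply: mem_tnth.
Qed.
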